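(* Let $f:\mathbb{R}^n\times\mathbb{R}^m\to\mathbb{R}^n$ be continuous, let $\mathbb{Y}\subseteq\mathbb{R}^n\times\mathbb{R}^m$ be a non-empty constraint set and let $\ell_1,\ell_2:\mathbb{Y}\to\mathbb{R}$ be stage costs. Assume that the system $x(k+1)=f(x(k),u(k))$ is strictly dissipative for the cost functions $\ell_1$ and $\ell_2$ at the same equilibrium $(x^e,u^e)$. Then the system is strictly dissipative for the cost function $\ell_\mu=\mu\ell_1+(1-\mu)\ell_2$ at $(x^e,u^e)$ for all $\mu\in[0,1]$.
   Context: Let $\mathbb{X}:=\{x\in\mathbb{R}^n : \text{there is } u\in\mathbb{R}^m \text{ with } (x,u)\in\mathbb{Y}\}$. An equilibrium is a pair $(x^e,u^e)\in\mathbb{Y}$ with $x^e=f(x^e,u^e)$. $\|\cdot\|$ is an arbitrary norm on $\mathbb{R}^n$. $\mathcal{K}_\infty$ is the set of continuous, strictly increasing, unbounded functions $\alpha:[0,\infty)\to[0,\infty)$ with $\alpha(0)=0$. The system is strictly dissipative for the stage cost $\ell$ at an equilibrium $(x^e,u^e)$ if there exist a storage function $\lambda:\mathbb{X}\to\mathbb{R}$, bounded on bounded subsets of $\mathbb{X}$ and bounded from below on $\mathbb{X}$, and $\alpha\in\mathcal{K}_\infty$ such that for all $(x,u)\in\mathbb{Y}$ with $f(x,u)\in\mathbb{X}$ $$\ell(x,u)-\ell(x^e,u^e)+\lambda(x)-\lambda(f(x,u))\ge\alpha(\|x-x^e\|).$$ *)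

(* Defs.v *)
From mathcomp Require Import all_boot all_order all_algebra.
From mathcomp Require Import all_classical all_reals all_analysis.

Set Implicit Arguments.
Unset Strict Implicit.
Unset Printing Implicit Defensive.

Import Order.TTheory GRing.Theory Num.Theory.
Import numFieldNormedType.Exports.

Local Open Scope classical_set_scope.
Local Open Scope ring_scope.

(* An arbitrary norm has to be a predicate on functions: the canonical
   [normedModType] structure of ['rV[R]_n] only provides the maximum norm. *)
Record is_norm (R : realType) (n : nat) (N : 'rV[R]_n -> R) : Prop := IsNorm {
  is_norm_triangle : forall x y, N (x + y) <= N x + N y;
  is_norm_homogeneous : forall (a : R) x, N (a *: x) = `|a| * N x;
  is_norm_definite : forall x, N x = 0 -> x = 0
}.

(* Functions defined on a subset ([0, +oo[, X or Y) are represented by total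
   functions; every condition below only involves their values on that subset. *)
Record class_Kinfty (R : realType) (alpha : R -> R) : Prop := ClassKinfty {
  Kinfty_ge0 : forall r, 0 <= r -> 0 <= alpha r;
  Kinfty_continuous : {within `[0, +oo[, continuous alpha};
  Kinfty_increasing : {in `[0, +oo[ &, {homo alpha : r s / r < s}};
  Kinfty_unbounded : ~ has_ubound (alpha @` `[0, +oo[);
  Kinfty0 : alpha 0 = 0
}.

Definition state_set (R : realType) (n m : nat)
    (Y : set ('rV[R]_n * 'rV[R]_m)) : set 'rV[R]_n :=
  [set x | exists u, Y (x, u)].

Definition equilibrium (R : realType) (n m : nat)
    (f : 'rV[R]_n * 'rV[R]_m -> 'rV[R]_n) (Y : set ('rV[R]_n * 'rV[R]_m))
    (xe : 'rV[R]_n) (ue : 'rV[R]_m) : Prop :=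
  Y (xe, ue) /\ xe = f (xe, ue).

Record storage_function (R : realType) (n : nat) (N : 'rV[R]_n -> R)
    (X : set 'rV[R]_n) (lambda : 'rV[R]_n -> R) : Prop := StorageFunction {
  storage_bounded : forall B, B `<=` X ->
    [bounded N x | x in B] -> [bounded lambda x | x in B];
  storage_lbound : has_lbound (lambda @` X)
}.

Definition strictly_dissipative (R : realType) (n m : nat)
    (N : 'rV[R]_n -> R) (f : 'rV[R]_n * 'rV[R]_m -> 'rV[R]_n)
    (Y : set ('rV[R]_n * 'rV[R]_m)) (ell : 'rV[R]_n * 'rV[R]_m -> R)
    (xe : 'rV[R]_n) (ue : 'rV[R]_m) : Prop :=
  exists (lambda : 'rV[R]_n -> R) (alpha : R -> R),
    [/\ storage_function N (state_set Y) lambda,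
        class_Kinfty alpha &
        forall x u, Y (x, u) -> state_set Y (f (x, u)) ->
          ell (x, u) - ell (xe, ue) + lambda x - lambda (f (x, u))
            >= alpha (N (x - xe))].

(* Main.v *)
Require Import Defs.
From mathcomp Require Import all_boot all_order all_algebra.
From mathcomp Require Import all_classical all_reals all_analysis.
From mathcomp Require Import lra.
Import Order.TTheory GRing.Theory Num.Theory.
Import numFieldNormedType.Exports.
Local Open Scope classical_set_scope.
Local Open Scope ring_scope.

(** The dissipation inequality is jointly linear in the stage cost [ell], the
    storage function [lambda] and the comparison function [alpha], and both
    the storage functions and the class K-infinity are closed under addition
    and under multiplication by a positive constant.  Hence the stage costs for
    which the system is strictly dissipative at a fixed equilibrium form a
    convex cone ([strictly_dissipativeD], [strictly_dissipativeZ]), and a convex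
    combination with [0 < mu < 1] belongs to it, with storage function
    [mu * lambda1 + (1 - mu) * lambda2].  The zero function is not of class
    K-infinity, so this cone need not contain the zero cost: the two endpoints
    [mu = 0] and [mu = 1] are separate, and there the combination is one of the
    two given costs. *)

Lemma class_KinftyZ (R : realType) (c : R) (alpha : R -> R) :
  0 < c -> class_Kinfty alpha -> class_Kinfty (fun r => c * alpha r).
Proof.
move=> c0 [a0 ac ai au az]; split.
- by move=> r r0; rewrite mulr_ge0 ?a0// ltW.
- by move=> x; apply: cvgM; [exact: cvg_cst|exact: ac].
- by move=> r s rI sI rs; rewrite ltr_pM2l// ai.
- move=> [M ubM]; apply: au; exists (c^-1 * M) => _ [r rI <-].
  by rewrite ler_pdivlMl//; apply: ubM; exists r.
- by rewrite az mulr0.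
Qed.

(** Unboundedness survives because the second summand is nonnegative: any upper
    bound of the sum would bound the first summand. *)
Lemma class_KinftyD (R : realType) (alpha beta : R -> R) :
  class_Kinfty alpha -> class_Kinfty beta ->
  class_Kinfty (fun r => alpha r + beta r).
Proof.
move=> [a0 ac ai au az] [b0 bc bi _ bz]; split.
- by move=> r r0; rewrite addr_ge0 ?a0 ?b0.
- by move=> x; apply: cvgD; [exact: ac|exact: bc].
- by move=> r s rI sI rs; rewrite ltrD ?ai ?bi.
- move=> [M ubM]; apply: au; exists M => _ [r rI <-].
  have r0 : 0 <= r by move: rI; rewrite /= in_itv/= andbT.
  have : alpha r + beta r <= M by apply: ubM; exists r.
  by apply: le_trans; rewrite lerDl b0.
- by rewrite az bz addr0.
Qed.

(** For nonempty [B] this is [ex_bound], which asks for a proper filter.  The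
    storage condition also quantifies over the empty set, whose filter is not
    proper, and the characterization still holds there. *)
Lemma bounded_onP (R : realType) (T : Type) (B : set T) (g : T -> R) :
  [bounded g x | x in B] <-> exists K, forall x, B x -> `|g x| <= K.
Proof.
split=> [[K [_ hK]]|[K hK]].
  by exists (K + 1) => x Bx; apply: (hK (K + 1)) => //; rewrite ltrDl.
exists K; split; first exact: num_real.
by move=> M KM x Bx; rewrite /= (le_trans (hK x Bx))// ltW.
Qed.

Lemma storage_functionZ (R : realType) (n : nat) (N : 'rV[R]_n -> R)
    (X : set 'rV[R]_n) (c : R) (lambda : 'rV[R]_n -> R) :
  0 < c -> storage_function N X lambda ->
  storage_function N X (fun x => c * lambda x).
Proof.
move=> c0 [lb [M lbM]]; split.
- move=> B BX /(lb _ BX)/bounded_onP[K hK].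
  apply/bounded_onP; exists (c * K) => x Bx.
  by rewrite normrM gtr0_norm// ler_pM2l// hK.
- exists (c * M) => _ [x Xx <-].
  by rewrite ler_pM2l//; apply: lbM; exists x.
Qed.

Lemma storage_functionD (R : realType) (n : nat) (N : 'rV[R]_n -> R)
    (X : set 'rV[R]_n) (lambda1 lambda2 : 'rV[R]_n -> R) :
  storage_function N X lambda1 -> storage_function N X lambda2 ->
  storage_function N X (fun x => lambda1 x + lambda2 x).
Proof.
move=> [b1 [M1 lb1]] [b2 [M2 lb2]]; split.
- move=> B BX NB; have /bounded_onP[K1 h1] := b1 B BX NB.
  have /bounded_onP[K2 h2] := b2 B BX NB.
  apply/bounded_onP; exists (K1 + K2) => x Bx.
  by rewrite (le_trans (ler_normD _ _))// lerD ?h1 ?h2.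
- exists (M1 + M2) => _ [x Xx <-].
  by rewrite lerD//; [apply: lb1|apply: lb2]; exists x.
Qed.

Lemma strictly_dissipativeZ (R : realType) (n m : nat) (N : 'rV[R]_n -> R)
    (f : 'rV[R]_n * 'rV[R]_m -> 'rV[R]_n) (Y : set ('rV[R]_n * 'rV[R]_m))
    (c : R) (ell : 'rV[R]_n * 'rV[R]_m -> R) xe ue :
  0 < c -> strictly_dissipative N f Y ell xe ue ->
  strictly_dissipative N f Y (fun p => c * ell p) xe ue.
Proof.
move=> c0 [lambda [alpha [sl ka dis]]].
exists (fun x => c * lambda x), (fun r => c * alpha r); split.
- exact: storage_functionZ.
- exact: class_KinftyZ.
- by move=> x u Yxu Xf; rewrite -!mulrBr -mulrDr -mulrBr ler_pM2l// dis.
Qed.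

Lemma strictly_dissipativeD (R : realType) (n m : nat) (N : 'rV[R]_n -> R)
    (f : 'rV[R]_n * 'rV[R]_m -> 'rV[R]_n) (Y : set ('rV[R]_n * 'rV[R]_m))
    (ell1 ell2 : 'rV[R]_n * 'rV[R]_m -> R) xe ue :
  strictly_dissipative N f Y ell1 xe ue ->
  strictly_dissipative N f Y ell2 xe ue ->
  strictly_dissipative N f Y (fun p => ell1 p + ell2 p) xe ue.
Proof.
move=> [l1 [a1 [s1 k1 d1]]] [l2 [a2 [s2 k2 d2]]].
exists (fun x => l1 x + l2 x), (fun r => a1 r + a2 r); split.
- exact: storage_functionD.
- exact: class_KinftyD.
- by move=> x u Yxu Xf; have := d1 x u Yxu Xf; have := d2 x u Yxu Xf; lra.
Qed.

Theorem theorem4p6 (R : realType) (n m : nat)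
  (N : 'rV[R]_n -> R) (hN : is_norm N)
  (f : 'rV[R]_n * 'rV[R]_m -> 'rV[R]_n) (hf : continuous f)
  (Y : set ('rV[R]_n * 'rV[R]_m)) (hY : Y !=set0)
  (ell1 ell2 : 'rV[R]_n * 'rV[R]_m -> R)
  (xe : 'rV[R]_n) (ue : 'rV[R]_m) (he : equilibrium f Y xe ue)
  (h1 : strictly_dissipative N f Y ell1 xe ue)
  (h2 : strictly_dissipative N f Y ell2 xe ue) :
  forall mu : R, 0 <= mu <= 1 ->
    strictly_dissipative N f Y
      (fun p => mu * ell1 p + (1 - mu) * ell2 p) xe ue.
Proof.
move=> mu /andP[mu0 mu1].
have [->|mu_neq0] := eqVneq mu 0.
  rewrite (_ : (fun p => _) = ell2)//.
  by apply/funext => p; rewrite mul0r add0r subr0 mul1r.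
have [->|mu_neq1] := eqVneq mu 1.
  rewrite (_ : (fun p => _) = ell1)//.
  by apply/funext => p; rewrite subrr mul0r addr0 mul1r.
apply: strictly_dissipativeD; apply: strictly_dissipativeZ => //.
- by rewrite lt_neqAle eq_sym mu_neq0.
- by rewrite subr_gt0 lt_neqAle mu_neq1.
Qed.
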